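(* Let $X$ be a second countable Baire complex topological vector space with $\dim(X)>1$, and let $\Gamma$ be a subset of $\mathcal{B}(X)$. Then $$HC(\Gamma)=\bigcap_{n\geq 1}\bigcup_{T\in\Gamma}T^{-1}(U_n),$$ where $(U_n)_{n\geq 1}$ is a countable basis of the topology of $X$. As a consequence, $HC(\Gamma)$ is a $G_\delta$ set.
   Context: $\mathcal{B}(X)$ denotes the set of all continuous linear operators on $X$. For $\Gamma\subset\mathcal{B}(X)$ and $x\in X$, the orbit of $x$ under $\Gamma$ is $Orb(\Gamma,x)=\{Tx : T\in\Gamma\}$. A vector $x\in X$ is called a hypercyclic vector for $\Gamma$ if $Orb(\Gamma,x)$ is a dense subset of $X$; $HC(\Gamma)$ denotes the set of all hypercyclic vectors for $\Gamma$. A subset of a topological space is called a $G_\delta$ set if it is a countable intersection of open sets.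
   Formalization: The sets U_n of the countable basis are assumed nonempty; if some U_n were empty the right-hand side would be empty and the identity would fail whenever HC(Γ) is nonempty (e.g. X = ℂ², Γ = B(X)). *)

(* Defs.v *)
From HB Require Import structures.
From mathcomp Require Import all_boot all_order all_algebra.
From mathcomp Require Import all_classical all_reals all_analysis.

Set Implicit Arguments.
Unset Strict Implicit.
Unset Printing Implicit Defensive.

Import Order.TTheory GRing.Theory Num.Theory.
Import numFieldNormedType.Exports.
Local Open Scope classical_set_scope.
Local Open Scope ring_scope.

Definition baire_space (T : topologicalType) : Prop :=
  forall F : (set T)^nat,
    (forall n, open (F n) /\ dense (F n)) -> dense (\bigcap_n F n).

Definition linearly_independent (K : fieldType) (V : lmodType K) (B : set V) :=
  forall (s : seq V) (c : V -> K), uniq s -> (forall x, x \in s -> B x) ->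
    \sum_(x <- s) c x *: x = 0 -> forall x, x \in s -> c x = 0.

Definition generating (K : fieldType) (V : lmodType K) (B : set V) :=
  forall v : V, exists (s : seq V) (c : V -> K),
    (forall x, x \in s -> B x) /\ v = \sum_(x <- s) c x *: x.

Definition hamel_basis (K : fieldType) (V : lmodType K) (B : set V) :=
  linearly_independent B /\ generating B.

(* dim V > n, for a possibly infinite dimension, the dimension of V being the
   cardinality of its Hamel bases. *)
Definition dim_gt (K : fieldType) (V : lmodType K) (n : nat) : Prop :=
  exists B : set V, hamel_basis B /\ ~~ (B #<= `I_n)%card.

Section Hypercyclicity.
Context (K : numFieldType) (X : topologicalLmodType K).

Definition continuous_operators : set {linear X -> X} :=
  [set T : {linear X -> X} | continuous (T : X -> X)].

Definition Orb (Gamma : set {linear X -> X}) (x : X) : set X :=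
  [set T x | T in Gamma].

Definition hypercyclic_vector (Gamma : set {linear X -> X}) (x : X) : Prop :=
  dense (Orb Gamma x).

Definition HC (Gamma : set {linear X -> X}) : set X :=
  [set x | hypercyclic_vector Gamma x].

End Hypercyclicity.
Arguments continuous_operators {K} X.

(* A countable topological basis, enumerated, without empty members: [basis]
   allows the empty set as a member, but the usual criterion for density,
   meeting every set of a basis, only holds for nonempty ones. Repetitions
   are allowed. *)
Definition countable_basis (T : topologicalType) (U : (set T)^nat) : Prop :=
  basis (range U) /\ forall n, U n !=set0.

(* Main.v *)
Require Import Defs.
From HB Require Import structures.
From mathcomp Require Import all_boot all_order all_algebra.
From mathcomp Require Import all_classical all_reals all_analysis.
From mathcomp Require Import borel_hierarchy complex.

(** A vector is hypercyclic when its orbit is dense, and density need only be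
    tested against the nonempty members of a basis ([dense_basisP]). So [x] is
    hypercyclic iff for every [n] some [T x] with [T] in [Gamma] lies in [U n],
    which is membership in the announced intersection ([HC_basisE]). Each
    [T @^-1` U n] is open because [T] is continuous and [U n] is open, hence so
    is its union over [Gamma], however large [Gamma] is; the countable
    intersection of these unions is then a G-delta set. A sequence [U] of
    nonempty basic sets exists by second countability
    ([second_countable_basis]). *)

Local Open Scope classical_set_scope.
Local Open Scope ring_scope.

Lemma dense_basisP (T : topologicalType) (B : set (set T)) (D : set T) :
  basis B -> dense D <-> (forall V, B V -> V !=set0 -> V `&` D !=set0).
Proof.
move=> [Bopen Bnbhs]; split=> [Dd V BV V0|BD O [x Ox] Oopen].
  by apply: Dd => //; exact: Bopen.
have [V [BV Vx] VO] := Bnbhs x O (open_nbhs_nbhs (conj Oopen Ox)).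
have [y [Vy Dy]] := BD V BV (ex_intro _ x Vx).
by exists y; split => //; exact: VO.
Qed.

(** Discarding the empty set from a countable basis leaves a countable basis;
    it is nonempty, as it covers the point of [T], and can therefore be
    enumerated by all of [nat]. *)
Lemma second_countable_basis (T : topologicalType) (x0 : T) :
  @second_countable T -> exists U : (set T)^nat, countable_basis U.
Proof.
move=> [B Bcount [Bopen Bnbhs]].
pose B' := [set V | B V /\ V !=set0].
have B'basis : basis B'.
  split=> [V [BV _]|x N /Bnbhs[V [BV Vx] VN]]; first exact: Bopen.
  by exists V => //; split => //; split => //; exists x.
have B'count : countable B'.
  by apply: sub_countable Bcount; apply: subset_card_le => V [].
have [V [B'V _] _] := B'basis.2 x0 setT filterT.
have [B'0|[f]] := pfcard_geP B'count; first by move: B'V; rewrite B'0.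
exists f; split=> [|n]; last by have [] : B' (f n) by exact: funS.
suff -> : range f = B' by [].
apply/seteqP; split=> [_ [n _ <-]|]; [exact: funS|exact: surj].
Qed.

Lemma HC_basisE (K : numFieldType) (X : topologicalLmodType K)
    (Gamma : set {linear X -> X}) (U : (set X)^nat) : countable_basis U ->
  HC Gamma = \bigcap_n \bigcup_(T in Gamma) ((T : X -> X) @^-1` U n).
Proof.
move=> [Ubasis U0]; apply/seteqP; split=> x.
  move=> /(dense_basisP _ _ _ Ubasis) xd n _.
  have [|y [Uy [T GT Txy]]] := xd (U n) _ (U0 n); first by exists n.
  by exists T => //=; rewrite Txy.
move=> xU; apply/(dense_basisP _ _ _ Ubasis) => _ [n _ <-] _.
by have [T GT UTx] := xU n I; exists (T x); split => //; exists T.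
Qed.

Theorem proposition2p8 (R : realType) (X : topologicalLmodType R[i])
    (X2 : @second_countable X) (XB : baire_space X) (Xdim : dim_gt X 1)
    (Gamma : set {linear X -> X}) (GammaB : Gamma `<=` continuous_operators X) :
  (forall U : (set X)^nat, countable_basis U ->
     HC Gamma = \bigcap_n \bigcup_(T in Gamma) ((T : X -> X) @^-1` U n)) /\
  Gdelta (HC Gamma).
Proof.
split=> [U|]; first exact: HC_basisE.
have [U Ub] := second_countable_basis X 0 X2.
exists (fun n => \bigcup_(T in Gamma) ((T : X -> X) @^-1` U n)); last first.
  exact: HC_basisE.
move=> n; apply: bigcup_open => T GT.
apply: open_comp => [x _|]; first exact: GammaB.
by apply: Ub.1.1; exists n.
Qed.
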